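(* We have $$f_{1110}(x)=\frac{1-5x+8x^2-5x^3+x^4-(1-3x+x^2+2x^3)\sqrt{1-4x+2x^2+x^4}}{2x^2(1-2x)^2}$$ as formal power series in $x$, where $f_{1110}(x)=\sum_{n\ge 0} b_n(1110)x^n$ and $b_n(1110)$ is the number of ascent sequences of length $n$ that avoid both patterns $021$ and $1110$.
   Context: For a finite sequence $w=w_1\cdots w_n$ of integers, $\mathrm{asc}(w)$ is the number of indices $1\le i\le n-1$ with $w_i<w_{i+1}$. An ascent sequence of length $n\ge 1$ is a sequence $a_1\cdots a_n$ of non-negative integers such that $a_1=0$ and $a_i\le \mathrm{asc}(a_1\cdots a_{i-1})+1$ for $1<i\le n$; there is exactly one (empty) ascent sequence of length $0$. A sequence $\pi=\pi_1\cdots\pi_n$ contains a pattern $\tau=\tau_1\cdots\tau_m$ if there are indices $1\le i_1<\cdots<i_m\le n$ such that for all $j,k\in\{1,\dots,m\}$: $\pi_{i_j}<\pi_{i_k}$ iff $\tau_j<\tau_k$, and $\pi_{i_j}=\pi_{i_k}$ iff $\tau_j=\tau_k$; otherwise $\pi$ avoids $\tau$. For a pattern $\tau$, $B_n(\tau)$ is the set of ascent sequences of length $n$ avoiding both $021$ and $\tau$ (with $B_0(\tau)$ consisting of the empty sequence), and $b_n(\tau)=|B_n(\tau)|$. The square root denotes the formal power series square root with constant term $1$. *)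

(* Defs.v *)
From HB Require Import structures.
From mathcomp Require Import all_boot all_order all_algebra.
From mathcomp Require Import fraction finmap.
From mathcomp Require Import boolp classical_sets functions cardinality.

Set Implicit Arguments.
Unset Strict Implicit.
Unset Printing Implicit Defensive.

Import GRing.Theory.

Local Open Scope ring_scope.

(* A formal power series is its sequence of coefficients. [fps R] is an alias
   of [nat -> R], so that the canonical product is the Cauchy product and not
   the pointwise product of functions. *)
Definition fps (R : Type) := nat -> R.

HB.instance Definition _ (R : zmodType) :=
  GRing.Zmodule.copy (fps R) (nat -> R).

Section FpsRing.
Variable R : comNzRingType.
Implicit Types f g h : fps R.

Definition fps_one : fps R := fun n => (n == 0%N)%:R.

Definition fps_mul f g : fps R := fun n => \sum_(i < n.+1) f i * g (n - i)%N.

Let trunc n f : {poly R} := \poly_(i < n) f i.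

Let fps_mul_trunc n k f g :
  (k < n)%N -> fps_mul f g k = (trunc n f * trunc n g)`_k.
Proof.
move=> kn; rewrite coefM; apply: eq_bigr => i _; rewrite !coef_poly.
have ik : (i <= k)%N by rewrite -ltnS.
by rewrite (leq_ltn_trans ik kn) (leq_ltn_trans (leq_subr i k) kn).
Qed.

Let coef_trunc n k f : (k < n)%N -> (trunc n f)`_k = f k.
Proof. by move=> kn; rewrite coef_poly kn. Qed.

Let coefM_eq (p p' q q' : {poly R}) k :
  (forall i, (i <= k)%N -> p`_i = p'`_i) ->
  (forall i, (i <= k)%N -> q`_i = q'`_i) -> (p * q)`_k = (p' * q')`_k.
Proof.
move=> hp hq; rewrite !coefM; apply: eq_bigr => i _.
by rewrite hp ?hq // ?leq_subr // -ltnS.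
Qed.

Let fps_mulA : associative fps_mul.
Proof.
move=> f g h; apply/funext => n.
rewrite !(@fps_mul_trunc n.+1) //.
transitivity ((trunc n.+1 f * (trunc n.+1 g * trunc n.+1 h))`_n).
  apply: coefM_eq => // i i_n.
  by rewrite coef_trunc ?ltnS // (@fps_mul_trunc n.+1).
rewrite mulrA; apply: coefM_eq => // i i_n.
by rewrite coef_trunc ?ltnS // (@fps_mul_trunc n.+1).
Qed.

Let fps_mulC : commutative fps_mul.
Proof. by move=> f g; apply/funext => n; rewrite !(@fps_mul_trunc n.+1) // mulrC. Qed.

Let fps_mul1 : left_id fps_one fps_mul.
Proof.
move=> f; apply/funext => n.
rewrite /fps_mul big_ord_recl /= subn0 /fps_one mul1r big1 ?addr0 // => i _.
by rewrite mul0r.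
Qed.

Let fps_mulDl : left_distributive fps_mul +%R.
Proof.
move=> f g h; apply/funext => n.
rewrite -[RHS]/(fps_mul f h n + fps_mul g h n) /fps_mul -big_split; apply: eq_bigr => i _ /=.
by rewrite -mulrDl.
Qed.

Let fps_one_neq0 : fps_one != 0.
Proof.
by apply/eqP => /(congr1 (fun f : fps R => f 0%N)) /eqP; rewrite oner_eq0.
Qed.

HB.instance Definition _ := GRing.Zmodule_isComNzRing.Build (fps R)
  fps_mulA fps_mulC fps_mul1 fps_mulDl fps_one_neq0.

Lemma fps_coefD f g n : (f + g) n = f n + g n. Proof. by []. Qed.
Lemma fps_coefN f n : (- f) n = - f n. Proof. by []. Qed.
Lemma fps_coef0 n : (0 : fps R) n = 0. Proof. by []. Qed.
Lemma fps_coef1 n : (1 : fps R) n = (n == 0%N)%:R. Proof. by []. Qed.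
Lemma fps_coefM f g n : (f * g) n = \sum_(i < n.+1) f i * g (n - i)%N.
Proof. by []. Qed.

Definition fps_unit : {pred fps R} := [pred f | `[< exists g, g * f = 1 >]].

Definition fps_inv f : fps R := xget f [set g | g * f = 1]%classic.

Let fps_mulVf : {in fps_unit, left_inverse 1 fps_inv *%R}.
Proof. by move=> f /asboolP /(xgetPex f). Qed.

Let fps_unitP f g : g * f = 1 -> fps_unit f.
Proof. by move=> gf; apply/asboolP; exists g. Qed.

Let fps_inv_out : {in [predC fps_unit], fps_inv =1 id}.
Proof.
move=> f fNunit; rewrite /fps_inv; case: xgetP => // g _ gf.
by move: fNunit; rewrite !inE => /asboolP; case; exists g.
Qed.

HB.instance Definition _ := GRing.ComNzRing_hasMulInverse.Build (fps R)
  fps_mulVf fps_unitP fps_inv_out.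

End FpsRing.

Section FpsDomain.
Variable R : idomainType.

Let fps_valuation (f : fps R) : f != 0 ->
  exists2 m, f m != 0 & forall i, (i < m)%N -> f i = 0.
Proof.
move=> f0; have ex_n : exists n, f n != 0.
  apply: contrapT => /forallNP f_eq0; move/eqP: f0; apply; apply/funext => n.
  by apply/eqP/negPn/negP/f_eq0.
case: (ex_minnP ex_n) => m fm mP; exists m => // i i_m.
by apply/eqP; apply: contraTT i_m => /mP; rewrite -leqNgt.
Qed.

Let fps_integral : GRing.integral_domain_axiom (fps R).
Proof.
move=> f g fg0; apply/norP => -[/fps_valuation[m fm fP]].
move=> /fps_valuation[k gk gP].
have /eqP := congr1 (fun h : fps R => h (m + k)%N) fg0.
have m_lt : (m < (m + k).+1)%N by rewrite ltnS leq_addr.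
rewrite fps_coefM fps_coef0 (bigD1 (Ordinal m_lt)) //= addKn big1 ?addr0.
  by rewrite mulf_eq0 (negPf fm) (negPf gk).
move=> i; rewrite -val_eqE /= neq_ltn => /orP[i_m | m_i].
  by rewrite fP // mul0r.
by rewrite gP ?mulr0 // ltn_subLR ?ltn_add2r // -ltnS.
Qed.

HB.instance Definition _ :=
  GRing.ComUnitRing_isIntegral.Build (fps R) fps_integral.

End FpsDomain.

Definition fps_X (R : comNzRingType) : fps R := fun n => (n == 1%N)%:R.
Arguments fps_X {R}.

(* Meaningful when [f 0 = 1]: see [fps_sqrtP] for existence over [rat]. *)
Definition fps_sqrt (R : comNzRingType) (f : fps R) : fps R :=
  xget 0 [set s : fps R | s 0%N = 1 /\ s ^+ 2 = f]%classic.

Section FpsSqrt.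
Variable f : fps rat.
Hypothesis f0 : f 0%N = 1.

Let next (s : seq rat) : rat :=
  (f (size s) - \sum_(1 <= i < size s) s`_i * s`_(size s - i)) / 2%:R.

Let root_seq n := iter n (fun s => rcons s (next s)) [:: 1].

Let size_root_seq n : size (root_seq n) = n.+1.
Proof. by elim: n => //= n IHn; rewrite size_rcons IHn. Qed.

Let root : fps rat := fun n => (root_seq n)`_n.

Let nth_root_seq n i : (i <= n)%N -> (root_seq n)`_i = root i.
Proof.
elim: n => [|n IHn]; first by rewrite leqn0 => /eqP->.
rewrite leq_eqVlt => /orP[/eqP-> // | i_n].
by rewrite [root_seq _]/= nth_rcons size_root_seq i_n IHn.
Qed.

Let rootS n :
  root n.+1 = (f n.+1 - \sum_(1 <= i < n.+1) root i * root (n.+1 - i)%N) / 2%:R.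
Proof.
rewrite /root [root_seq _]/= nth_rcons size_root_seq ltnn eqxx /next.
rewrite size_root_seq; congr ((_ - _) / _); apply: eq_big_nat => i /andP[i0 i_n].
by rewrite !nth_root_seq // leq_subLR -add1n leq_add2r.
Qed.

Lemma fps_sqrt_exists : exists s : fps rat, s 0%N = 1 /\ s ^+ 2 = f.
Proof.
exists root; split=> //; apply/funext => -[|n]; rewrite expr2 fps_coefM.
  by rewrite big_ord1 f0 mulr1.
rewrite big_ord_recl big_ord_recr /= subn0 /bump /= add1n subnn.
have -> : root 0 = 1 by [].
rewrite mul1r mulr1 rootS big_add1 /= big_mkord.
under eq_bigr do rewrite add1n.
set S := \sum_(_ < _) _.
rewrite addrCA -mulr2n -[_ *+ 2]mulr_natr mulfVK //.
by rewrite addrC subrK.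
Qed.

Lemma fps_sqrtP : fps_sqrt f 0%N = 1 /\ fps_sqrt f ^+ 2 = f.
Proof. exact: (xgetPex 0 fps_sqrt_exists). Qed.

Lemma fps_sqrt_unique (s : fps rat) : s 0%N = 1 -> s ^+ 2 = f -> s = fps_sqrt f.
Proof.
case: fps_sqrtP => r0 rf s0 sf; have /eqP := etrans sf (esym rf).
rewrite eqf_sqr => /orP[/eqP // | /eqP s_r].
by have := congr1 (fun h : fps rat => h 0%N) s_r; rewrite fps_coefN s0 r0.
Qed.

End FpsSqrt.

Local Open Scope nat_scope.

(* Words are 0-indexed: the letter [w_i] of the text is [nth 0 w i.-1]. *)
Definition asc (w : seq nat) : nat :=
  #|[set i : 'I_(size w).-1 | nth 0 w i < nth 0 w i.+1]|.

Definition is_ascent_seq (w : seq nat) : Prop :=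
  (0 < size w -> nth 0 w 0 = 0) /\
  (forall i, 0 < i < size w -> nth 0 w i <= asc (take i w) + 1).

Definition contains (p t : seq nat) : Prop :=
  exists2 e : 'I_(size t) -> 'I_(size p),
    {homo e : j k / j < k} &
    forall j k : 'I_(size t),
      (nth 0 p (e j) < nth 0 p (e k) <-> nth 0 t j < nth 0 t k) /\
      (nth 0 p (e j) = nth 0 p (e k) <-> nth 0 t j = nth 0 t k).

Definition avoids (p t : seq nat) : Prop := ~ contains p t.

Definition Bset (n : nat) (t : seq nat) : set (seq nat) :=
  [set w | [/\ size w = n, is_ascent_seq w, avoids w [:: 0; 2; 1]
             & avoids w t]]%classic.

Definition bnum (n : nat) (t : seq nat) : nat := #|` fset_set (Bset n t)|.

(* [fset_set] is the empty set on infinite sets, hence the finiteness of [Bset]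
   is what makes [bnum] its cardinality. *)
Lemma ascent_seq_lt_size (w : seq nat) : is_ascent_seq w -> all (ltn^~ (size w)) w.
Proof.
move=> [w0 wP]; apply/(all_nthP 0) => -[|i] i_w; first by rewrite w0.
apply: leq_ltn_trans (wP i.+1 i_w) (leq_ltn_trans _ i_w).
rewrite addn1 ltnS /asc.
apply: (leq_trans (max_card _)).
by rewrite card_ord size_takel // ltnW.
Qed.

Lemma finite_Bset n t : finite_set (Bset n t).
Proof.
pose F (w : n.-tuple 'I_n) : seq nat := [seq val i | i <- w].
apply: (@sub_finite_set _ _ (F @` setT)%classic); last exact: finite_image.
move=> w [wn /ascent_seq_lt_size w_lt _ _]; rewrite wn in w_lt.
have sz : size (pmap (insub : nat -> option 'I_n) w) == n.
  by rewrite size_pmap_sub -{2}wn -all_count.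
exists (Tuple sz) => //; rewrite /F /= (pmap_filter (insubK _)).
by apply/all_filterP; apply: sub_all w_lt => i i_n; rewrite /= insubT.
Qed.

Definition gf (t : seq nat) : fps rat := fun n => (bnum n t)%:R%R.

(* Main.v *)
Require Import Defs.
From mathcomp Require Import all_boot all_order all_algebra.
From mathcomp Require Import fraction finmap ring zify.
From mathcomp Require Import boolp classical_sets cardinality.
Import GRing.Theory.
Set Implicit Arguments.
Unset Strict Implicit.
Unset Printing Implicit Defensive.
Local Open Scope ring_scope.

(** A word starting with 0 avoids 021 iff its nonzero letters weakly increase,
    and then it avoids 1110 iff no 0 follows three copies of a nonzero letter.
    So the number of ways to complete a prefix with maximum m > 0 depends only
    on its slack e = asc - m, on whether its last letter is 0, and on whether m
    has occurred once, twice, or some letter has occurred three times.  A new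
    maximum moves the slack to any j <= e, and only repeating m just after a 0
    raises it, by 1.  The resulting linear system for the generating functions
    of the completions has a unique solution, and an explicit one is a
    combination of A^e and u^e, where u = (1 - x)/(1 - 2x) comes from the
    prefixes after which 0 is forbidden and A is the power series root of the
    kernel (1 - x)^2 - (1 - x)(1 - 2x - x^2) A + x^3 A^2, whose discriminant is
    (1 - x)^2 (1 - 4x + 2x^2 + x^4). *)

(** * Power series and the linear system *)

Section FpsComplements.
Variable R : comNzRingType.
Implicit Types f g : fps R.

Lemma fps_coefXM f n : (fps_X * f) n.+1 = f n.
Proof.
rewrite fps_coefM big_ord_recl mul0r add0r big_ord_recl /= mul1r subSS subn0.
by rewrite big1 ?addr0 // => i _; rewrite mul0r.
Qed.

Lemma fps_coefXM0 f : (fps_X * f) 0%N = 0.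
Proof. by rewrite fps_coefM big_ord1 mul0r. Qed.

Lemma fps_coef_sum (I : Type) (r : seq I) (P : pred I) (F : I -> fps R) n :
  (\sum_(i <- r | P i) F i) n = \sum_(i <- r | P i) F i n.
Proof. exact: (big_morph (fun f : fps R => f n)). Qed.

Lemma fps_coef_exp_lt f k n : f 0%N = 0 -> (n < k)%N -> (f ^+ k) n = 0.
Proof.
move=> f0; elim: k n => // k IHk n nk; rewrite exprS fps_coefM big1 // => i _.
case: i => [[|i] /= i_n]; first by rewrite f0 mul0r.
by rewrite IHk ?mulr0 //; lia.
Qed.

(** With f = 1 - h, the inverse is the geometric series in h. Its coefficient n needs only the
    powers h^k with k <= n, because h has no constant term. *)
Lemma fps_unit_coef0 f : f 0%N = 1 -> f \is a GRing.unit.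
Proof.
move=> f0; pose h := 1 - f.
have h0 : h 0%N = 0 by rewrite /h fps_coefD fps_coefN f0 subrr.
pose g : fps R := fun n => (\sum_(k < n.+1) h ^+ k) n.
suff fg : f * g = 1 by apply/unitrPr; exists g.
apply/funext => n.
(* Coefficient n of the product sees only the coefficients of [g] up to n, so [g] may be replaced by
   a single partial sum, for which the product telescopes to 1 - h^(n+1). *)
have -> : (f * g) n = (f * \sum_(k < n.+1) h ^+ k) n.
  rewrite !fps_coefM; apply: eq_bigr => i _; congr (_ * _).
  rewrite /g !fps_coef_sum -[in LHS](big_mkord predT (fun k => (h ^+ k) (n - i)%N)).
  rewrite -[in RHS](big_mkord predT (fun k => (h ^+ k) (n - i)%N)).
  rewrite [RHS](@big_cat_nat _ _ _ (n - i).+1) ?ltnS ?leq_subr //=.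
  rewrite [X in _ + X]big1_seq ?addr0 // => k; rewrite mem_index_iota => /and3P[_ ik _].
  exact: fps_coef_exp_lt.
have -> : f = 1 - h by rewrite opprB addrC subrK.
rewrite -opprB mulNr -subrX1 opprB fps_coefD fps_coefN.
by rewrite fps_coef_exp_lt // subr0.
Qed.

End FpsComplements.

(* Shape of a prefix with maximum [m > 0]: its last letter is [m] ([N]) or 0
   ([Z]), and the index counts the occurrences of [m], except that [N3] means
   that some nonzero letter has occurred at least three times. *)
Inductive state := N1 | N2 | N3 | Z1 | Z2.

(** The summands stand for the next letter: 0 (forbidden in [N3]), the current maximum, or a new
    maximum leaving slack j. A general [M] lets the same operator act on counts and on power
    series. *)
Definition step (M : nmodType) (F : nat -> state -> M) (e : nat) (s : state) : M :=
  match s with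
  | N1 => F e Z1 + F e N2 + \sum_(j < e.+1) F j N1
  | N2 => F e Z2 + F e N3 + \sum_(j < e.+1) F j N1
  | N3 => F e N3 + \sum_(j < e.+1) F j N3
  | Z1 => F e Z1 + F e.+1 N2 + \sum_(j < e.+1) F j N1
  | Z2 => F e Z2 + F e.+1 N3 + \sum_(j < e.+1) F j N1
  end.

Fixpoint completions (n : nat) : nat -> state -> nat :=
  if n is n'.+1 then step (completions n') else fun _ _ => 1%N.

(** * Explicit solution of the linear system *)

Section LinearSystem.
Variable R : comNzRingType.
Variables x y u A : R.
Hypothesis yE : y = 1 + x * y.
Hypothesis uE : u - 1 = x * y * u.
(** This is (A - 1) / x, written without division. *)
Let r := y * (A + x * A + x ^+ 2 * y * A ^+ 2).
Hypothesis AE : A - 1 = x * r.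

Let a := 1 + x * u.

(** Closed form of 1 + x times the sum of the [N1] entries up to slack e. The value of [a] makes it
    equal 1 for the empty sum, at e = -1. *)
Let G e := a * A ^+ e.+1 - x * u ^+ e.+2.

Definition closed_form (e : nat) (s : state) : R :=
  match s with
  | N1 => a * r * A ^+ e - x * y * u ^+ e.+2
  | N2 => y * a * A ^+ e.+1
  | N3 => y * u ^+ e.+1
  | Z1 => y * (G e + x * (y * a * A ^+ e.+2))
  | Z2 => y * (G e + x * (y * u ^+ e.+2))
  end.

Let sum_N1 e : x * (\sum_(j < e.+1) closed_form j N1) = G e - 1.
Proof.
(* The sum telescopes: the subtracted term is the formula of [G] at j - 1. *)
have xN1 j : x * closed_form j N1 = G j - (a * A ^+ j - x * u ^+ j.+1).
  apply: subr0_eq; rewrite /G /= !exprS.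
  transitivity (a * A ^+ j * (x * r - (A - 1)) - x * u * u ^+ j * (x * y * u - (u - 1))).
    ring.
  by rewrite AE uE !subrr !mulr0 subr0.
elim: e => [|e IHe].
  by rewrite big_ord1 xN1 expr0 expr1 /a; ring.
by rewrite big_ord_recr mulrDr IHe xN1 /=; rewrite /G; ring.
Qed.

Let sum_N3 e : x * (\sum_(j < e.+1) closed_form j N3) = u ^+ e.+1 - 1.
Proof.
elim: e => [|e IHe]; first by rewrite big_ord1 /= expr1 uE mulrA.
rewrite big_ord_recr mulrDr IHe /= [u ^+ e.+2]exprS.
by rewrite -{4}[u](subrK 1) uE /= exprS; ring.
Qed.

(** Once the sums are replaced by their closed forms, the difference of the two sides is an explicit
    combination of the relations for y and u. The equation for A enters through [sum_N1]. *)
Lemma closed_form_step e s : closed_form e s = 1 + x * step closed_form e s.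
Proof.
have y0 : y - (1 + x * y) = 0 by rewrite -yE subrr.
have u0 : x * y * u - (u - 1) = 0 by rewrite uE subrr.
case: s; rewrite [step _ _ _]/= mulrDr ?sum_N1 ?sum_N3 /=; apply: subr0_eq.
- transitivity (G e * (y - (1 + x * y))); last by rewrite y0 mulr0.
  by rewrite /G !exprS /r; ring.
- transitivity (G e * (y - (1 + x * y))
                - x * y * u * u ^+ e * (x * y * u - (u - 1))).
    by rewrite /G !exprS; ring.
  by rewrite y0 u0 !mulr0 subr0.
- transitivity (u ^+ e.+1 * (y - (1 + x * y))); last by rewrite y0 mulr0.
  by rewrite !exprS; ring.
- transitivity ((G e + x * y * a * A ^+ e.+2) * (y - (1 + x * y)));
    last by rewrite y0 mulr0.
  by rewrite /G !exprS; ring.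
- transitivity ((G e + x * y * u ^+ e.+2) * (y - (1 + x * y)));
    last by rewrite y0 mulr0.
  by rewrite /G !exprS; ring.
Qed.

Lemma closed_form_N1_0 : x * closed_form 0 N1 = (1 + x * u) * A - x * u ^+ 2 - 1.
Proof. by have := sum_N1 0; rewrite big_ord1. Qed.

End LinearSystem.

Section Completions.
Variables (R : comNzRingType) (y u A : fps R).
Hypothesis yE : y = 1 + fps_X * y.
Hypothesis uE : u - 1 = fps_X * y * u.
Hypothesis AE : A - 1 = fps_X * (y * (A + fps_X * A + fps_X ^+ 2 * y * A ^+ 2)).

(** The system F = 1 + x * step F gives the coefficients of index n+1 from those of index n by the
    same [step] that defines [completions]. *)
Lemma completions_closed_form n e s :
  (completions n e s)%:R = closed_form fps_X y u A e s n.
Proof.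
elim: n e s => [|n IHn] e s; rewrite (closed_form_step yE uE AE) fps_coefD.
  by rewrite fps_coefXM0 addr0.
rewrite fps_coefXM fps_coef1 add0r.
have sumE t : (\sum_(j < e.+1) completions n j t)%:R
    = (\sum_(j < e.+1) closed_form fps_X y u A j t) n.
  by rewrite fps_coef_sum natr_sum; apply: eq_bigr => j _; apply: IHn.
by case: s; rewrite /= !natrD sumE !IHn.
Qed.

End Completions.

(** * The kernel root and the generating function *)

Section GeneratingFunction.
Let x : fps rat := fps_X.
Let D : fps rat := fps_sqrt (1 - 4 * x + 2 * x ^+ 2 + x ^+ 4).
Let P : fps rat := 1 - 2 * x - x ^+ 2.

Let disc0 : (1 - 4 * x + 2 * x ^+ 2 + x ^+ 4) 0%N = 1.
Proof.
have -> : 1 - 4 * x + 2 * x ^+ 2 + x ^+ 4 = 1 + x * (x ^+ 3 + 2 * x - 4) by ring.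
by rewrite fps_coefD fps_coefXM0 addr0.
Qed.

(* [B = A / (1 - x)] is obtained as the inverse of [(P + D) / 2], which has
   constant term 1, rather than as [(P - D) / (2 x^3)]. *)
Lemma kernel_root_exists :
  exists B : fps rat, 1 - P * B + x ^+ 3 * B ^+ 2 = 0 /\ 2 * x ^+ 3 * B = P - D.
Proof.
have [D0 D2] := fps_sqrtP disc0; rewrite -/D in D0 D2.
have P0 : P 0%N = 1.
  have -> : P = 1 + x * (- 2 - x) by rewrite /P; ring.
  by rewrite fps_coefD fps_coefXM0 addr0.
pose W : fps rat := fun n => (P n + D n) / 2%:R.
have W2 : 2 * W = P + D.
  apply/funext => n; rewrite -[2 * W]/((1 *+ 2) * W) mulrnAl mul1r mulr2n fps_coefD.
  by rewrite -mulr2n -mulr_natr divfK.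
have W0 : W 0%N = 1 by rewrite /W P0 D0.
have WU := fps_unit_coef0 W0.
have two0 : (2 : fps rat) != 0.
  by apply/eqP => /(congr1 (fun f : fps rat => f 0%N)).
(* Since P^2 - 4x^3 = D^2, the roots of this quadratic are (P + D) / 2 and (P - D) / 2. Multiplying
   by 4 completes the square. *)
have quad : W ^+ 2 - W * P + x ^+ 3 = 0.
  apply: (mulfI two0); apply: (mulfI two0); rewrite !mulr0.
  transitivity ((2 * W - P) ^+ 2 - P ^+ 2 + 4 * x ^+ 3); first by ring.
  have -> : 2 * W - P = D by rewrite W2; ring.
  by rewrite D2 /P; ring.
have BW : W^-1 * W = 1 := mulVr WU.
exists W^-1; split.
  transitivity ((W ^+ 2 - W * P + x ^+ 3) * W^-1 ^+ 2
     + (1 - W^-1 * W) * (1 + W^-1 * W - W^-1 * P)); first by ring.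
  by rewrite quad BW subrr !mul0r addr0.
(* The two roots have product x^3, so x^3 / W is the other root (P - D) / 2. *)
transitivity (2 * W^-1 * (W ^+ 2 - W * P + x ^+ 3) + 2 * P * (W^-1 * W)
  - (2 * W) * (W^-1 * W)); first by ring.
by rewrite quad BW W2; ring.
Qed.

(** The recurrence amounts to (1 - x) g = 1 + x^2 C, where [C] is the series of
    [completions n 0 N1]. The closed form of [C] then gives the formula after clearing
    denominators. *)
Lemma gf_equation (g : fps rat) :
  g 0%N = 1 -> g 1%N = 1 ->
  (forall n, g n.+2 = g n.+1 + (completions n 0 N1)%:R) ->
  g * (2 * x ^+ 2 * (1 - 2 * x) ^+ 2) =
  1 - 5 * x + 8 * x ^+ 2 - 5 * x ^+ 3 + x ^+ 4
    - (1 - 3 * x + x ^+ 2 + 2 * x ^+ 3) * D.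
Proof.
move=> g0 g1 gS; have [B [kernelB DB]] := kernel_root_exists.
have unit_sub (h : fps rat) : 1 - x * h \is a GRing.unit.
  by apply: fps_unit_coef0; rewrite fps_coefD fps_coefN fps_coefXM0 subr0.
(* The shapes [x * 1] and [x * 2] match [unit_sub]; thus y = 1 / (1 - x) and w = 1 / (1 - 2x). *)
pose y := (1 - x * 1)^-1; have y1 : (1 - x) * y = 1.
  by rewrite -[x in 1 - x]mulr1 mulrV.
pose w := (1 - x * 2)^-1; have w1 : (1 - 2 * x) * w = 1.
  by rewrite [2 * x]mulrC mulrV.
pose u := (1 - x) * w; pose A := (1 - x) * B.
have zu : (1 - 2 * x) * u = 1 - x by rewrite /u mulrCA w1 mulr1.
have yE : y = 1 + x * y by rewrite -{1}y1; ring.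
have uE : u - 1 = x * y * u.
  have -> : x * y * u = ((1 - x) * y) * (x * w) by rewrite /u; ring.
  by rewrite y1 mul1r -w1 /u; ring.
have AE : A - 1 = x * (y * (A + x * A + x ^+ 2 * y * A ^+ 2)).
  apply: subr0_eq; have yA : y * A = B by rewrite /A mulrCA mulrA y1 mul1r.
  transitivity ((A - 1) - (x * (1 + x) * (y * A) + x ^+ 3 * (y * A) ^+ 2)).
    by ring.
  rewrite yA; transitivity (- (1 - P * B + x ^+ 3 * B ^+ 2)).
    by rewrite /A /P; ring.
  by rewrite kernelB oppr0.
pose C := closed_form x y u A 0 N1.
have gE : (1 - x) * g = 1 + x * (x * C).
  suff gE : g = 1 + x * g + x * (x * C) by rewrite mulrBl mul1r {1}gE; ring.
  apply/funext => -[|[|n]]; rewrite !fps_coefD ?fps_coefXM0 ?fps_coefXM.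
  - by rewrite g0 !addr0.
  - by rewrite g1 g0 fps_coefXM0 add0r addr0.
  - by rewrite gS add0r (completions_closed_form yE uE AE).
have x1 : 1 - x != 0 by apply: contra_eqN y1 => /eqP->; rewrite mul0r eq_sym oner_eq0.
apply: (mulfI x1); rewrite [LHS]mulrA gE (closed_form_N1_0 uE AE).
(* Regrouped so that u occurs only in (1 - 2x) u = 1 - x, and B only in 2 x^3 B = P - D. *)
transitivity (2 * x ^+ 2 * (1 - x) * (1 - 2 * x) ^+ 2
  + (1 - x) * (1 - 2 * x) * (1 - 2 * x + x * ((1 - 2 * x) * u)) * (2 * x ^+ 3 * B)
  - 2 * x ^+ 4 * ((1 - 2 * x) * u) ^+ 2); first by rewrite /A; ring.
by rewrite zu DB /P; ring.
Qed.

End GeneratingFunction.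

(** * Words and their completions *)

Section Words.
Local Open Scope nat_scope.

Lemma asc_rcons (w : seq nat) a :
  w != [::] -> asc (rcons w a) = asc w + (last 0 w < a).
Proof.
have ascE v : asc v = \sum_(i < (size v).-1) (nth 0 v i < nth 0 v i.+1).
  by rewrite /asc -sum1_card big_mkcond; apply: eq_bigr => i _; rewrite inE; case: ifP.
case: w => // b w _; rewrite !ascE size_rcons /= big_ord_recr /=.
rewrite -rcons_cons !nth_rcons ltnSn ltnn eqxx nth_last; congr (_ + _).
by apply: eq_bigr => i _; rewrite !nth_rcons ltn_ord [i < size (b :: w)]ltnS (ltnW (ltn_ord i)).
Qed.

Lemma ascent_rcons (w : seq nat) a : w != [::] ->
  is_ascent_seq (rcons w a) <-> is_ascent_seq w /\ a <= (asc w).+1.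
Proof.
move=> w0; have sw : 0 < size w by case: w w0.
split=> [[h0 hi]|[[h0 hi] ha]].
  split; last first.
    have := hi (size w); rewrite size_rcons sw ltnSn => /(_ isT).
    by rewrite nth_rcons ltnn eqxx -cats1 take_size_cat // addn1.
  split=> [_|i /andP[i0 iw]]; first by move: h0; rewrite size_rcons nth_rcons sw; apply.
  have := hi i; rewrite size_rcons i0 ltnS ltnW // => /(_ isT).
  by rewrite nth_rcons iw -cats1 takel_cat // ltnW.
split=> [_|i]; first by rewrite nth_rcons sw h0.
rewrite size_rcons ltnS => /andP[i0]; rewrite leq_eqVlt => /orP[/eqP->|iw].
  by rewrite nth_rcons ltnn eqxx -cats1 take_size_cat // addn1.
by rewrite nth_rcons iw -cats1 takel_cat ?hi ?i0 // ltnW.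
Qed.

(** * Occurrences of the two patterns *)

Lemma contains021P w : contains w [:: 0; 2; 1] <->
  exists i j k, [/\ i < j, j < k, k < size w,
    nth 0 w i < nth 0 w k & nth 0 w k < nth 0 w j].
Proof.
split=> [[e eM eP]|[i [j [k [ij jk kw ik kj]]]]].
  exists (e (@Ordinal 3 0 isT)), (e (@Ordinal 3 1 isT)), (e (@Ordinal 3 2 isT)).
  split; rewrite ?eM //.
  - by apply/(eP (@Ordinal 3 0 isT) (@Ordinal 3 2 isT)).1.
  - by apply/(eP (@Ordinal 3 2 isT) (@Ordinal 3 1 isT)).1.
have jw := ltn_trans jk kw; have iw := ltn_trans ij jw.
(* The default of [nth] is never reached, as q stays below 3. *)
exists (fun q => nth (Ordinal iw) [:: Ordinal iw; Ordinal jw; Ordinal kw] q).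
  by move=> [[|[|[|//]]] ?] [[|[|[|//]]] ?] //=; rewrite (ltn_trans ij).
by move=> [[|[|[|//]]] ?] [[|[|[|//]]] ?] /=; lia.
Qed.

Lemma contains1110P w : contains w [:: 1; 1; 1; 0] <->
  exists i j k l, [/\ [&& i < j, j < k, k < l & l < size w],
    nth 0 w j = nth 0 w i, nth 0 w k = nth 0 w i & nth 0 w l < nth 0 w i].
Proof.
split=> [[e eM eP]|[i [j [k [l [/and4P[ij jk kl lw] eij eik li]]]]]].
  exists (e (@Ordinal 4 0 isT)), (e (@Ordinal 4 1 isT)),
    (e (@Ordinal 4 2 isT)), (e (@Ordinal 4 3 isT)).
  split; rewrite ?eM //=.
  - by apply/(eP (@Ordinal 4 1 isT) (@Ordinal 4 0 isT)).2.
  - by apply/(eP (@Ordinal 4 2 isT) (@Ordinal 4 0 isT)).2.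
  - by apply/(eP (@Ordinal 4 3 isT) (@Ordinal 4 0 isT)).1.
have kw := ltn_trans kl lw; have jw := ltn_trans jk kw; have iw := ltn_trans ij jw.
exists (fun q => nth (Ordinal iw)
  [:: Ordinal iw; Ordinal jw; Ordinal kw; Ordinal lw] q).
  by move=> [[|[|[|[|//]]]] ?] [[|[|[|[|//]]]] ?] //= _; lia.
by move=> [[|[|[|[|//]]]] ?] [[|[|[|[|//]]]] ?] /=; lia.
Qed.

Lemma count_mem_take (w : seq nat) v i : i < size w ->
  count_mem v (take i.+1 w) = count_mem v (take i w) + (nth 0 w i == v).
Proof. by move=> iw; rewrite (take_nth 0 iw) -cats1 count_cat /= addn0. Qed.

Lemma leq_count_mem_take (w : seq nat) v i j :
  i <= j -> count_mem v (take i w) <= count_mem v (take j w).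
Proof. by move=> ij; rewrite -(subnKC ij) takeD count_cat leq_addr. Qed.

(** The last occurrence of v among the first n letters works. Iterating extracts occurrences from
    right to left. *)
Lemma count_mem_take_gt (w : seq nat) v c n : c < count_mem v (take n w) ->
  exists k, [/\ k < n, k < size w, nth 0 w k = v & c <= count_mem v (take k w)].
Proof.
elim: n => [|n IHn]; first by rewrite take0.
have [nw|nw] := ltnP n (size w); last first.
  rewrite take_oversize ?(leqW nw) // -{1}(take_oversize nw) => /IHn[k [kn ? ? ?]].
  by exists k; split=> //; apply: leqW.
have [wn|wn] := eqVneq (nth 0 w n) v; rewrite count_mem_take //.
  by rewrite wn eqxx addn1 ltnS => cn; exists n; split.
rewrite (negPf wn) addn0 => /IHn[k [kn ? ? ?]].
by exists k; split=> //; apply: leqW.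
Qed.

Lemma count_mem_gt2P (w : seq nat) v : 2 < count_mem v w <->
  exists i j k, [/\ [&& i < j, j < k & k < size w],
    nth 0 w i = v, nth 0 w j = v & nth 0 w k = v].
Proof.
split=> [|[i [j [k [/and3P[ij jk kw] wi wj wk]]]]].
  rewrite -{1}(take_size w) => /count_mem_take_gt[k [kw _ wk]].
  move=> /count_mem_take_gt[j [jk _ wj]] /count_mem_take_gt[i [ij _ wi _]].
  by exists i, j, k; split=> //; apply/and3P.
have := leq_count_mem_take w v ij; have := leq_count_mem_take w v jk.
have := leq_count_mem_take w v kw; rewrite take_size.
have jw := ltn_trans jk kw; have iw := ltn_trans ij jw.
by rewrite !count_mem_take // wi wj wk eqxx; lia.
Qed.

(** A new occurrence must use a as its last letter, so a exceeds some letter and lies below another.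
    Conversely the initial 0 and any letter above a > 0 complete the pattern; that letter is not the
    initial one. *)
Lemma contains021_rcons (w : seq nat) a : w != [::] -> nth 0 w 0 = 0 ->
  contains (rcons w a) [:: 0; 2; 1] <->
  contains w [:: 0; 2; 1] \/ (0 < a /\ ~~ all (leq^~ a) w).
Proof.
move=> wN w0; have sw : 0 < size w by case: w wN {w0}.
rewrite !contains021P size_rcons; split.
  move=> [i [j [k [ij jk]]]]; rewrite ltnS leq_eqVlt => /predU1P[kE|kw].
    rewrite {}kE in jk *; have iw := ltn_trans ij jk.
    rewrite !nth_rcons ltnn eqxx iw jk => ia aj; right; split.
      exact: leq_ltn_trans ia.
    by apply/allPn; exists (nth 0 w j); rewrite ?mem_nth // -ltnNge.
  have jw := ltn_trans jk kw; have iw := ltn_trans ij jw.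
  by rewrite !nth_rcons kw iw jw => ? ?; left; exists i, j, k; split.
move=> [[i [j [k [ij jk kw ik kj]]]]|[a0 /allPn[b /(nthP 0)[j jw <-{b}]]]].
  have jw := ltn_trans jk kw; have iw := ltn_trans ij jw.
  by exists i, j, k; rewrite !nth_rcons kw iw jw; split=> //; apply: leqW.
rewrite -ltnNge => aj; exists 0, j, (size w).
rewrite !nth_rcons ltnn eqxx sw jw w0; split=> //.
by case: j aj {jw} => //; rewrite w0.
Qed.

(** A new occurrence uses a as its final letter, after three copies of a larger letter. *)
Lemma contains1110_rcons (w : seq nat) a :
  contains (rcons w a) [:: 1; 1; 1; 0] <->
  contains w [:: 1; 1; 1; 0] \/ exists2 v, a < v & 2 < count_mem v w.
Proof.
rewrite !contains1110P size_rcons; split.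
  move=> [i [j [k [l [/and4P[ij jk kl]]]]]].
  rewrite ltnS leq_eqVlt => /predU1P[lE|lw].
    rewrite {}lE in kl *; have jw := ltn_trans jk kl; have iw := ltn_trans ij jw.
    rewrite !nth_rcons ltnn eqxx iw jw kl => ji ki ai; right.
    exists (nth 0 w i) => //; apply/count_mem_gt2P; exists i, j, k.
    by split=> //; apply/and3P.
  have kw := ltn_trans kl lw; have jw := ltn_trans jk kw; have iw := ltn_trans ij jw.
  rewrite !nth_rcons kw iw jw lw => ? ? ?; left; exists i, j, k, l.
  by split=> //; apply/and4P.
move=> [[i [j [k [l [/and4P[ij jk kl lw] ? ? ?]]]]]|].
  have kw := ltn_trans kl lw; have jw := ltn_trans jk kw; have iw := ltn_trans ij jw.
  exists i, j, k, l; rewrite !nth_rcons kw iw jw lw; split=> //.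
  by apply/and4P; split=> //; apply: leqW.
move=> [v av /count_mem_gt2P[i [j [k [/and3P[ij jk kw] wi wj wk]]]]].
have jw := ltn_trans jk kw; have iw := ltn_trans ij jw.
exists i, j, k, (size w); rewrite !nth_rcons ltnn eqxx iw jw kw wi wj wk.
by split=> //; apply/and4P.
Qed.

(** * Admissible words and their enumeration *)

Definition zero_allowed (w : seq nat) : bool :=
  all (fun v => (v == 0) || (count_mem v w <= 2)) w.

(** For a > 0 no test for 1110 appears: when no letter exceeds a, appending a cannot end this
    pattern. For a = 0 only 1110 can be created. *)
Definition allowed (w : seq nat) (a : nat) : bool :=
  if a == 0 then zero_allowed w else all (leq^~ a) w && (a <= (asc w).+1).

Definition admissible (w : seq nat) : Prop :=
  [/\ is_ascent_seq w, avoids w [:: 0; 2; 1] & avoids w [:: 1; 1; 1; 0]].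

Lemma zero_allowedP w :
  reflect (forall v, 0 < v -> count_mem v w <= 2) (zero_allowed w).
Proof.
apply: (iffP allP) => [h v v0|h v _]; last by case: v => //= v; apply: h.
have [/h|/count_memPn-> //] := boolP (v \in w).
by rewrite eqn0Ngt v0.
Qed.

Lemma admissible_rcons w a : w != [::] ->
  admissible (rcons w a) <-> admissible w /\ allowed w a.
Proof.
move=> wN; have sw : 0 < size w by case: w wN.
rewrite /admissible /avoids (propext (contains1110_rcons _ _)).
rewrite (propext (ascent_rcons _ wN)); split.
  move=> [[wP aw]]; have w0 := wP.1 sw.
  rewrite (propext (contains021_rcons _ wN w0)) => N021 N1110; split.
    by split=> //; [move=> ? | move=> ?]; [apply: N021 | apply: N1110]; left.
  rewrite /allowed; case: (posnP a) => [a0|a0].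
    apply/zero_allowedP => v v0; rewrite leqNgt; apply/negP => cv.
    by apply: N1110; right; exists v; rewrite ?a0.
  rewrite aw andbT; apply/negPn/negP => ?.
  by apply: N021; right.
move=> [[wP N021 N1110]]; have w0 := wP.1 sw.
rewrite (propext (contains021_rcons _ wN w0)) /allowed; case: (posnP a) => [->|a0].
  move=> /zero_allowedP za; split=> // -[] // []//.
  by move=> v v0; rewrite ltnNge za.
move=> /andP[wa aw]; split=> // -[] //.
  by rewrite wa => -[].
move=> [v av]; rewrite (count_memPn _) //.
by apply/negP => /(allP wa); rewrite leqNgt av.
Qed.

Lemma admissible_catl w s : w != [::] -> admissible (w ++ s) -> admissible w.
Proof.
move=> wN; elim/last_ind: s => [|s a IHs]; first by rewrite cats0.
rewrite -rcons_cat => /admissible_rcons[|/IHs //].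
by case: w wN {IHs}.
Qed.

Definition next_letters (w : seq nat) : seq nat :=
  [seq a <- iota 0 (asc w).+2 | allowed w a].

Lemma mem_next_letters w a : (a \in next_letters w) = allowed w a.
Proof.
rewrite mem_filter mem_iota /= add0n ltnS andb_idr // /allowed.
by case: (posnP a) => [->|_] // /andP[].
Qed.

Fixpoint extensions (n : nat) (w : seq nat) : seq (seq nat) :=
  if n is n'.+1 then
    flatten [seq extensions n' (rcons w a) | a <- next_letters w]
  else [:: w].

Lemma rcons_neq_nil (T : eqType) (w : seq T) a : rcons w a != [::].
Proof. by case: w. Qed.

Lemma extensionsP n w v : w != [::] -> admissible w ->
  v \in extensions n w <->
  exists s, [/\ size s = n, v = w ++ s & admissible v].
Proof.
elim: n w v => [|n IHn] w v wN wA /=.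
  rewrite inE; split=> [/eqP->|[s [/size0nil -> ->]]]; last by rewrite cats0.
  by exists [::]; rewrite cats0.
split=> [/flatten_mapP[a]|[[|a s] [] // [sn] vE vA]].
  rewrite mem_next_letters => wa.
  have rA := (admissible_rcons a wN).2 (conj wA wa).
  move=> /(IHn _ _ (rcons_neq_nil _ _) rA).1[s [sn -> sA]].
  by exists (a :: s); rewrite /= sn -cat_rcons.
move: vE vA; rewrite -cat_rcons => -> {v} vA.
have rA : admissible (rcons w a) by apply: admissible_catl vA; apply: rcons_neq_nil.
apply/flatten_mapP; exists a; last by apply/IHn; rewrite ?rcons_neq_nil //; exists s.
have [_ wa] := (admissible_rcons a wN).1 rA.
by rewrite mem_next_letters.
Qed.

Lemma extensions_prefix n w v : v \in extensions n w -> prefix w v.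
Proof.
elim: n w => [|n IHn] w /=; first by rewrite inE => /eqP->; apply: prefix_refl.
move=> /flatten_mapP[a _ /IHn /prefixP[s ->]].
by rewrite cat_rcons prefix_prefix.
Qed.

(** Extensions through different next letters differ at position [size w]. *)
Lemma extensions_uniq n w : uniq (extensions n w).
Proof.
elim: n w => // n IHn w /=.
have: uniq (next_letters w) by rewrite filter_uniq ?iota_uniq.
elim: (next_letters w) => //= a r IHr /andP[ar /IHr r_uniq].
rewrite cat_uniq IHn r_uniq andbT /=.
apply/hasPn => v /flatten_mapP[b br /extensions_prefix/prefixP[s ->]].
apply/negP => /extensions_prefix/prefixP[t].
rewrite !cat_rcons => /eqP; rewrite eqseq_cat // eqxx /= => /andP[/eqP ba _].
by rewrite -ba br in ar.
Qed.

Lemma size_extensionsS n w : size (extensions n.+1 w) =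
  \sum_(0 <= a < (asc w).+2 | allowed w a) size (extensions n (rcons w a)).
Proof.
by rewrite /= size_flatten sumnE /shape -map_comp big_map big_filter.
Qed.

(** A nonempty ascent sequence starts with 0, and the enumeration has no repetition. *)
Lemma bnum_extensions n : bnum n.+1 [:: 1; 1; 1; 0] = size (extensions n [:: 0]).
Proof.
have zeroA : admissible [:: 0].
  split.
  - by split=> // i /andP[]; case: i.
  - by move=> /contains021P[i [j [k [ij jk kw _ _]]]]; move: kw; rewrite /=; lia.
  - by move=> /contains1110P[i [j [k [l [/and4P[ij jk kl lw] _ _ _]]]]]; move: lw; rewrite /=; lia.
rewrite /bnum; suff -> : Bset n.+1 [:: 1; 1; 1; 0] = [set` [fset w in extensions n [:: 0]]%fset]%classic.
  by rewrite set_fsetK card_fseq undup_id ?extensions_uniq.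
apply/seteqP; split=> w /=; rewrite inE.
  move=> [wn wasc w021 w1110]; apply/extensionsP => //.
  case: w wn wasc w021 w1110 => // a s [sn] wasc w021 w1110.
  have a0 : a = 0 by apply: wasc.1.
  by exists s; split=> //; rewrite a0.
by move=> /extensionsP[] // s [sn -> [? ? ?]]; split=> //=; rewrite sn.
Qed.

(** * States and their transitions *)

Lemma count_mem_rcons (w : seq nat) v a :
  count_mem v (rcons w a) = count_mem v w + (a == v).
Proof. by rewrite -cats1 count_cat /= addn0. Qed.

Lemma zero_allowed_rcons w a : (a == 0) || (count_mem a w <= 1) ->
  zero_allowed (rcons w a) = zero_allowed w.
Proof.
move=> aw; apply/zero_allowedP/zero_allowedP => wP v v0.
  by apply: leq_trans (wP v v0); rewrite count_mem_rcons leq_addr.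
rewrite count_mem_rcons; have [av|_] := eqVneq a v; last by rewrite addn0 wP.
by rewrite -av; rewrite -av in v0; move: aw v0; case: (a) => //= ? ?; lia.
Qed.

Lemma zero_allowed_rcons_gt1 w a :
  0 < a -> 1 < count_mem a w -> zero_allowed (rcons w a) = false.
Proof.
move=> a0 aw; apply/zero_allowedP => /(_ a a0).
by rewrite count_mem_rcons eqxx; lia.
Qed.

Lemma zero_allowed_rconsF w a :
  zero_allowed w = false -> zero_allowed (rcons w a) = false.
Proof.
apply: contraFF => /zero_allowedP wP; apply/zero_allowedP => v v0.
by apply: leq_trans (wP v v0); rewrite count_mem_rcons leq_addr.
Qed.

Definition in_state (w : seq nat) (m e : nat) (s : state) : Prop :=
  [/\ 0 < m, m \in w, all (leq^~ m) w, asc w = m + e &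
    match s with
    | N1 => [/\ last 0 w = m, count_mem m w = 1 & zero_allowed w]
    | N2 => [/\ last 0 w = m, count_mem m w = 2 & zero_allowed w]
    | N3 => last 0 w = m /\ zero_allowed w = false
    | Z1 => [/\ last 0 w = 0, count_mem m w = 1 & zero_allowed w]
    | Z2 => [/\ last 0 w = 0, count_mem m w = 2 & zero_allowed w]
    end].

(** Letters strictly between 0 and m are excluded by the presence of m. The new maxima run from m +
    1 to m + e + 1; each adds one ascent, so m + 1 + (e - j) leaves slack j, which is the index of
    the sum. *)
Lemma sum_allowed w m e s (F : nat -> nat) : in_state w m e s ->
  \sum_(0 <= a < (asc w).+2 | allowed w a) F a =
  (if zero_allowed w then F 0 else 0) + F m
    + \sum_(j < e.+1) F (m.+1 + (e - j)).
Proof.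
move=> [m0 mw wm wasc _].
have wall a : m <= a -> all (leq^~ a) w.
  by move=> ma; apply: sub_all wm => v /= vm; apply: leq_trans ma.
rewrite big_mkcond big_ltn //= {1}/allowed /= -addnA; congr (_ + _).
rewrite (@big_cat_nat _ _ _ m) //=; last by lia.
rewrite big1_seq ?add0n => [|a /andP[_]]; last first.
  rewrite mem_index_iota => /andP[a0 am]; rewrite /allowed eqn0Ngt a0 /=.
  by case: (boolP (all _ w)) => // /allP/(_ m mw); rewrite leqNgt am.
rewrite big_ltn; last by lia.
rewrite {1}/allowed eqn0Ngt m0 /= wall // wasc; have -> : m <= (m + e).+1 by lia.
congr (_ + _).
have -> : (m + e).+2 = e.+1 + m.+1 by lia.
rewrite -{1}[m.+1]add0n big_addn addnK big_mkord (reindex_inj rev_ord_inj) /=.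
apply: eq_bigr => j _; rewrite subSS addnC.
rewrite /allowed /= wall ?wasc; last by lia.
by have -> : m.+1 + (e - j) <= (m + e).+1 by lia.
Qed.

Lemma in_state_fresh w m e s j : in_state w m e s -> j < e.+1 ->
  in_state (rcons w (m.+1 + (e - j))) (m.+1 + (e - j)) j (if s is N3 then N3 else N1).
Proof.
move=> [m0 mw wm wasc ws] je; set a := m.+1 + _.
have am : m < a by rewrite /a; lia.
have ca : count_mem a w = 0.
  by apply/count_memPn/negP => /(allP wm); rewrite leqNgt am.
have lm : last 0 w <= m.
  by case: s ws => [[]|[]|[]|[]|[]] ->.
split; rewrite ?mem_rcons ?mem_head ?(leq_trans _ am) //.
- rewrite all_rcons leqnn; apply: sub_all wm => v /= vm; exact: leq_trans (ltnW am).
- by rewrite asc_rcons ?wasc ?(leq_ltn_trans lm am) /a; [lia | case: (w) mw].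
by case: s ws => [[_ _ ws]|[_ _ ws]|[_ ws]|[_ _ ws]|[_ _ ws]];
  rewrite last_rcons ?count_mem_rcons ?zero_allowed_rcons ?ca ?eqxx ?orbT.
Qed.

(** Appending 0 creates no ascent, so the slack is unchanged; [N3] contradicts [zero_allowed w]. *)
Lemma in_state_zero w m e s : in_state w m e s -> zero_allowed w ->
  in_state (rcons w 0) m e
    (match s with N1 => Z1 | N2 => Z2 | _ => s end).
Proof.
move=> [m0 mw wm wasc ws] wz.
split; rewrite ?mem_rcons ?inE ?mw ?orbT //.
- by rewrite all_rcons.
- by rewrite asc_rcons ?addn0 //; case: (w) mw.
case: s ws => [[_ cm _]|[_ cm _]|[_ nz]|[_ cm _]|[_ cm _]];
  rewrite ?last_rcons ?count_mem_rcons ?zero_allowed_rcons ?(ltn_eqF m0) ?addn0 //.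
by rewrite nz in wz.
Qed.

(** Repeating m > 0 creates an ascent exactly when the last letter is 0. *)
Lemma in_state_repeat w m e s : in_state w m e s ->
  match s with
  | N1 => in_state (rcons w m) m e N2
  | Z1 => in_state (rcons w m) m e.+1 N2
  | Z2 => in_state (rcons w m) m e.+1 N3
  | _ => in_state (rcons w m) m e N3
  end.
Proof.
move=> [m0 mw wm wasc ws]; have wN : w != [::] by case: (w) mw.
have mw' : m \in rcons w m by rewrite mem_rcons mem_head.
have wm' : all (leq^~ m) (rcons w m) by rewrite all_rcons leqnn.
case: s ws => [[ls cs zs]|[ls cs zs]|[ls nz]|[ls cs zs]|[ls cs zs]]; split=> //;
  rewrite ?asc_rcons ?ls ?ltnn ?m0 ?wasc ?addn0 ?addn1 ?addnS // last_rcons.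
- by rewrite count_mem_rcons eqxx cs zero_allowed_rcons ?cs ?orbT.
- by rewrite zero_allowed_rcons_gt1 ?cs.
- by rewrite zero_allowed_rconsF.
- by rewrite count_mem_rcons eqxx cs zero_allowed_rcons ?cs ?orbT.
- by rewrite zero_allowed_rcons_gt1 ?cs.
Qed.

(** Splitting by the next letter with [sum_allowed] reproduces [step] term by term. *)
Lemma size_extensions n w m e s :
  in_state w m e s -> size (extensions n w) = completions n e s.
Proof.
elim: n w m e s => [|n IHn] w m e s ws; first by [].
rewrite size_extensionsS (sum_allowed _ ws).
have -> : \sum_(j < e.+1) size (extensions n (rcons w (m.+1 + (e - j)))) =
          \sum_(j < e.+1) completions n j (if s is N3 then N3 else N1).
  by apply: eq_bigr => j _; apply: IHn; apply: in_state_fresh ws _.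
have -> : (if zero_allowed w then size (extensions n (rcons w 0)) else 0) =
    if s is N3 then 0 else completions n e (match s with N1 => Z1 | N2 => Z2 | _ => s end).
  have w0 := in_state_zero ws; case: ws w0 => _ _ _ _.
  by case: s => [[_ _ zw]|[_ _ zw]|[_ zw]|[_ _ zw]|[_ _ zw]] w0;
    rewrite zw //; apply: IHn (w0 zw).
have := in_state_repeat ws.
by case: s {ws} => /IHn ->.
Qed.

(** * Prefixes of zeros and the recurrence *)

(** A word of zeros has no ascent, so the next letter is 0 or 1; the letter 1 leads to [N1] with
    maximum 1 and slack 0. *)
Lemma size_extensionsS_zeros n w : w != [::] -> all (pred1 0) w ->
  size (extensions n.+1 w) = size (extensions n (rcons w 0)) + completions n 0 N1.
Proof.
move=> wN w0; have wE := all_pred1P _ _ w0.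
have nth_w i : nth 0 w i = 0 by rewrite wE nth_nseq if_same.
have asc0 : asc w = 0.
  by apply/eqP; rewrite cards_eq0; apply/eqP/setP => i; rewrite !inE !nth_w.
have last0 : last 0 w = 0 by rewrite -nth_last nth_w.
have z0 : zero_allowed w by apply: sub_all w0 => v /= ->.
have c1 : count_mem 1 w = 0 by rewrite wE count_nseq.
have w1 : in_state (rcons w 1) 1 0 N1.
  split=> //; rewrite ?mem_rcons ?mem_head ?asc_rcons ?asc0 ?last0 //.
    by rewrite all_rcons /=; apply: sub_all w0 => v /eqP->.
  by rewrite last_rcons count_mem_rcons c1 zero_allowed_rcons ?c1.
rewrite size_extensionsS asc0 big_mkcond big_ltn // big_ltn // big_geq //=.
rewrite addn0 /allowed /= z0 asc0 andbT (size_extensions n w1).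
by case: allP => // -[] v /(allP w0)/eqP->.
Qed.

(** The number of leading zeros does not matter, so the prefix 00 can be traded for 0 in the
    recurrence. *)
Lemma size_extensions_zeros n v w : v != [::] -> all (pred1 0) v ->
  w != [::] -> all (pred1 0) w -> size (extensions n v) = size (extensions n w).
Proof.
elim: n v w => // n IHn v w vN v0 wN w0; rewrite !size_extensionsS_zeros //.
by congr (_ + _); apply: IHn; rewrite ?rcons_neq_nil ?all_rcons.
Qed.

Lemma bnumSS n : bnum n.+2 [:: 1; 1; 1; 0] = bnum n.+1 [:: 1; 1; 1; 0] + completions n 0 N1.
Proof.
rewrite !bnum_extensions size_extensionsS_zeros //; congr (_ + _).
exact: size_extensions_zeros.
Qed.

Lemma bnum0 t : t != [::] -> bnum 0 t = 1.
Proof.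
move=> tN; suff -> : bnum 0 t = #|` [fset [::]]%fset : {fset seq nat}|.
  by rewrite cardfs1.
rewrite /bnum; suff -> : Bset 0 t = [set` [fset [::]]%fset]%classic by rewrite set_fsetK.
apply/seteqP; split=> w /=; rewrite inE; first by case=> /size0nil-> *.
move=> /eqP->; split=> //; first by split=> // i; rewrite ltn0 andbF.
  by move=> [e _ _]; case: (e (@Ordinal 3 0 isT)).
by case: t tN => // b t _ [e _ _]; case: (e (@Ordinal (size t).+1 0 isT)).
Qed.

End Words.

(* The quotient is taken in the field of fractions of the ring of formal power
   series over the rationals. *)
Theorem theorem3p6 :
  let x : fps rat := fps_X in
  tofrac (gf [:: 1; 1; 1; 0]%N) =
  tofrac (1 - 5 * x + 8 * x ^+ 2 - 5 * x ^+ 3 + x ^+ 4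
          - (1 - 3 * x + x ^+ 2 + 2 * x ^+ 3)
            * fps_sqrt (1 - 4 * x + 2 * x ^+ 2 + x ^+ 4))
  / tofrac (2 * x ^+ 2 * (1 - 2 * x) ^+ 2).
Proof.
move=> x; set den := 2 * _ * _.
have den0 : den != 0.
  have two0 : (2 : fps rat) != 0.
    by apply/eqP => /(congr1 (fun f : fps rat => f 0%N)).
  have x0 : x != 0 by apply/eqP => /(congr1 (fun f : fps rat => f 1%N)).
  have z0 : 1 - 2 * x != 0.
    rewrite [2 * x]mulrC; apply/eqP => /(congr1 (fun f : fps rat => f 0%N)).
    by rewrite fps_coefD fps_coefN fps_coefXM0.
  by rewrite /den; apply: mulf_neq0; rewrite ?mulf_neq0 // expf_neq0.
apply: (canRL (mulfK _)); first by rewrite tofrac_eq0.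
rewrite -tofracM gf_equation // => [||n]; rewrite /gf.
- by rewrite bnum0.
- by rewrite bnum_extensions.
- by rewrite bnumSS natrD.
Qed.
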